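(* Let $n\ge2$ and $\tau,\sigma>0$. For $1\le m\le n$, define $v^{(m,\tau)}\in\mathbb R^n$ by $$v_i^{(m,\tau)}=-\frac{H_{n,\tau}^{(m)}(h_i^{(\tau)})}{H_{n,\tau}'(h_i^{(\tau)})}.$$ These vectors form an orthogonal basis of $\mathbb R^n$, and $$E_{n;\tau,\sigma}v^{(m,\tau)}=\left(\frac{\tau}{\tau+\sigma}\right)^{(m-1)/2}v^{(m,\tau)}.$$ Consequently, $E_{n;\tau,\sigma}$ is symmetric positive definite. Its operator norm on $\mathbf 1_n^\perp$ is $\sqrt{\tau/(\tau+\sigma)}$, and $$\operatorname{spec}(E_{n;\tau,\sigma})=\left\{\left(\frac{\tau}{\tau+\sigma}\right)^{(m-1)/2}:1\le m\le n\right\}.$$ In particular, $\operatorname{spec}(E_n)=\{1,2^{-1/2},2^{-2/2},\ldots,2^{-(n-1)/2}\}$.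
   Context: Finite free additive convolution: for $p(x)=\sum_{k=0}^n(-1)^ka_kx^{n-k}$ and $q(x)=\sum_{k=0}^n(-1)^kb_kx^{n-k}$ with $a_0=b_0=1$, set $(p\boxplus_n q)(x)=\sum_{k=0}^n(-1)^kc_kx^{n-k}$ with $c_k=\sum_{i+j=k}\frac{(n-i)!(n-j)!}{n!(n-k)!}a_ib_j$; it preserves real-rootedness. $P_\alpha(x)=\prod_{i=1}^n(x-\alpha_i)$, and $\Omega(\alpha,\beta)\in\mathbb R^n$ is the vector of roots of $P_\alpha\boxplus_nP_\beta$ in increasing order, real analytic where the output roots are simple (in particular when one input is simple). $D_1\Omega$ is the $n\times n$ partial Jacobian with respect to the first argument. $H_{n,\tau}(x)=\exp(-\frac\tau2\partial_x^2)x^n=\tau^{n/2}\mathrm{He}_n(x/\sqrt\tau)$, with $\mathrm{He}_n$ the monic probabilists' Hermite polynomial; $h^{(\tau)}$ is its increasing root vector and $H_{n,\tau}^{(m)}$ its $m$-th derivative. $E_{n;\tau,\sigma}=D_1\Omega(h^{(\tau)},h^{(\sigma)})$ and $E_n=E_{n;\tau,\tau}$ (independent of $\tau$). $\mathbf 1_n$ is the all-ones vector; orthogonality and norms are Euclidean. *)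

(* Defs.v *)
From mathcomp Require Import all_boot all_order all_algebra.
From mathcomp Require Import all_classical all_reals all_analysis.
Import Order.TTheory GRing.Theory Num.Theory.
Import numFieldNormedType.Exports.

Set Implicit Arguments.
Unset Strict Implicit.
Unset Printing Implicit Defensive.

Local Open Scope ring_scope.

Section FiniteFreeConvolution.
Variables (R : realType) (n : nat).

(* The coefficient a_k in p = \sum_(k <= n) (-1)^k a_k X^(n-k). *)
Definition ecoef (p : {poly R}) (k : nat) : R := (-1) ^+ k * p`_(n - k).

Definition fconv_coef (p q : {poly R}) (k : nat) : R :=
  \sum_(i < n.+1) \sum_(j < n.+1 | (i + j)%N == k)
     ((n - i)`!%:R * (n - j)`!%:R) / (n`!%:R * (n - k)`!%:R)
     * ecoef p i * ecoef q j.

Definition fconv (p q : {poly R}) : {poly R} :=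
  \sum_(k < n.+1) ((-1) ^+ k * fconv_coef p q k) *: 'X^(n - k).

Definition poly_of_roots (alpha : 'rV[R]_n) : {poly R} :=
  \prod_(i < n) ('X - (alpha 0 i)%:P).

(* The roots of p, with multiplicity, in increasing order; such a vector is
   unique when it exists, i.e. when p is monic of degree n and real-rooted.
   For any other p the value is the dummy 0. *)
Definition root_vec (p : {poly R}) : 'rV[R]_n :=
  xget 0 [set w : 'rV[R]_n |
    (forall i j : 'I_n, (i <= j)%N -> w 0 i <= w 0 j)
    /\ poly_of_roots w = p]%classic.

Definition Omega (alpha beta : 'rV[R]_n) : 'rV[R]_n :=
  root_vec (fconv (poly_of_roots alpha) (poly_of_roots beta)).

(* The library's jacobian acts on row vectors from the right; the transpose is
   the usual matrix of partial derivatives, with (i, j) entry the derivative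
   of Omega_i with respect to alpha_j, acting on column vectors. *)
Definition D1Omega (alpha beta : 'rV[R]_n) : 'M[R]_n :=
  (jacobian (fun a => Omega a beta) alpha)^T.

End FiniteFreeConvolution.

Section Hermite.
Variables (R : realType) (n : nat).

(* exp(s d^2/dx^2) p; the omitted terms of the exponential series, those with
   k >= size p, vanish on p. *)
Definition exp_deriv2 (s : R) (p : {poly R}) : {poly R} :=
  \sum_(k < size p) (s ^+ k / k`!%:R) *: derivn k.*2 p.

Definition hermite (tau : R) : {poly R} := exp_deriv2 (- (tau / 2)) 'X^n.

Definition hermite_roots (tau : R) : 'rV[R]_n := root_vec n (hermite tau).

Definition hermite_jac (tau sigma : R) : 'M[R]_n :=
  D1Omega (hermite_roots tau) (hermite_roots sigma).

Definition hermite_vec (m : nat) (tau : R) : 'cV[R]_n :=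
  \col_(i < n) (- ((derivn m (hermite tau)).[hermite_roots tau 0 i]
                   / (deriv (hermite tau)).[hermite_roots tau 0 i])).

End Hermite.

Section Euclidean.
Variables (R : realType) (n : nat).

Definition dotv (u v : 'cV[R]_n) : R := \sum_(i < n) u i 0 * v i 0.

(* The library's norm on matrices is the sup norm. *)
Definition enorm (v : 'cV[R]_n) : R := Num.sqrt (dotv v v).

Definition positive_definite (A : 'M[R]_n) : Prop :=
  forall x : 'cV[R]_n, x != 0 -> 0 < dotv x (A *m x).

Definition opnorm_on (V : set 'cV[R]_n) (A : 'M[R]_n) : R :=
  sup [set enorm (A *m x) | x in [set x | V x /\ enorm x <= 1]]%classic.

Definition orth_ones : set 'cV[R]_n :=
  [set x | dotv (const_mx 1) x = 0]%classic.

(* Only the real eigenvalues: the whole spectrum when A is symmetric. *)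
Definition spec (A : 'M[R]_n) : set R := [set a | eigenvalue A a]%classic.

End Euclidean.

(* Main.v *)
From HB Require Import structures.
Require Import Defs.
From mathcomp Require Import all_boot all_order all_algebra.
From mathcomp Require Import all_classical all_reals all_analysis.
From mathcomp.real_closed Require polyrcf.
From mathcomp Require Import ring lra zify.
Import Order.TTheory GRing.Theory Num.Theory numFieldNormedType.Exports.

Set Implicit Arguments.
Unset Strict Implicit.
Unset Printing Implicit Defensive.

Local Open Scope ring_scope.

(** Convolution with the Hermite polynomial of parameter [sigma] is the operator
    [T = exp(- sigma/2 D^2)], and [T] sends [H_tau] to [H_(tau + sigma)]. Since the
    roots [w] of [T H_tau] are simple, the Jacobian at [h = h^(tau)] has entries
    [(T Q_j)(w_i) / (T H_tau)'(w_i)] with [Q_j = H_tau / (X - h_j)]. Lagrange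
    interpolation of [H_tau^(m)] at [h], together with [T D = D T], shows that it
    maps [v^(m, tau)] to [v^(m, tau + sigma)], a multiple of [v^(m, tau)] by
    scaling. Orthogonality of the [v^(m, tau)] is the discrete orthogonality of
    the lower Hermite polynomials on [h]. *)

(** The delicate point is differentiability of the root map at [h]. [root_vec] falls back on a dummy
    vector, so [T P_x] must be shown real-rooted for every [x] near [h], not only at [h]. Simplicity
    of the roots of [H_(tau + sigma)] gives this: sign changes across small windows around them
    survive small changes of the coefficients, which also makes the perturbed roots continuous at
    [h]. Differentiability then becomes algebra. Evaluating [T P_h - T P_x] at a perturbed root
    yields an exact identity [Omega x - Omega h = (x - h) C(x)] with [C] continuous at [h], and this
    forces [C(h)] to be the derivative. *)

Lemma derivn_eq0 (R : nzSemiRingType) (p : {poly R}) k :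
  (size p <= k)%N -> p^`(k) = 0.
Proof.
move=> hk; apply/polyP=> i; rewrite coef_derivn coef0 nth_default ?mul0rn //.
by rewrite (leq_trans hk) // leq_addr.
Qed.

(** * The operator [exp(s D^2)] and convolution with a Hermite polynomial *)

Section ExpDeriv2.
Variable R : realType.
Implicit Types (p q : {poly R}) (s t : R).

Lemma exp_deriv2E N s p : (size p <= N)%N ->
  exp_deriv2 s p = \sum_(k < N) (s ^+ k / k`!%:R) *: p^`(k.*2).
Proof.
move=> hN; rewrite /exp_deriv2 (big_ord_widen N
  (fun k : nat => (s ^+ k / k`!%:R) *: p^`(k.*2))) // big_mkcond.
apply: eq_bigr => k _; case: ltnP => // hk.
by rewrite derivn_eq0 ?scaler0 // -addnn (leq_trans hk) // leq_addr.
Qed.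

Lemma exp_deriv2_is_linear s : linear (@exp_deriv2 R s).
Proof.
move=> c p q; pose N := maxn (size p) (size q).
have hN : (size (c *: p + q)%R <= N)%N.
  rewrite (leq_trans (size_polyD _ _)) // geq_max leq_maxr andbT.
  by rewrite (leq_trans (size_scale_leq _ _)) ?leq_maxl.
rewrite !(@exp_deriv2E N) ?leq_maxl ?leq_maxr //.
rewrite scaler_sumr -big_split /=; apply: eq_bigr => k _.
by rewrite derivnD derivnZ scalerDr !scalerA mulrC.
Qed.

HB.instance Definition _ s := GRing.isLinear.Build R {poly R} {poly R} _ 
  (@exp_deriv2 R s) (exp_deriv2_is_linear s).

Lemma exp_deriv2_deriv s p : exp_deriv2 s p^`() = (exp_deriv2 s p)^`().
Proof.
rewrite (@exp_deriv2E (size p)); last first.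
  by have [->|/lt_size_deriv/ltnW] := eqVneq p 0; rewrite ?raddf0.
rewrite /exp_deriv2 raddf_sum; apply: eq_bigr => k _ /=.
by rewrite derivZ -derivSn derivnS.
Qed.

Lemma exp_deriv2_derivn s p m : exp_deriv2 s p^`(m) = (exp_deriv2 s p)^`(m).
Proof. by elim: m => // m IHm; rewrite !derivnS exp_deriv2_deriv IHm. Qed.

Lemma derivn_mulX (p : {poly R}) k :
  (p * 'X)^`(k) = p^`(k) * 'X + p^`(k.-1) *+ k.
Proof.
case: k => [|k]; first by rewrite !derivn0 mulr0n addr0.
by rewrite -[p * 'X]addr0 -[0 in LHS]/(0%:P) derivnMXaddC addrC.
Qed.

(** Since [D^(2k) X = X D^(2k) + 2k D^(2k-1)] and [2k / k! = 2 / (k-1)!], the commutator of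
    [exp(s D^2)] with [X] is [2 s D exp(s D^2)]. *)
Lemma exp_deriv2_mulX s p : exp_deriv2 s (p * 'X) =
  exp_deriv2 s p * 'X + (2 * s) *: (exp_deriv2 s p)^`().
Proof.
pose N := (size p).+1.
have hpX : (size (p * 'X)%R <= N.+1)%N.
  by rewrite (leq_trans (size_polyMleq _ _)) // size_polyX addn2.
rewrite (exp_deriv2E s hpX).
under eq_bigr do rewrite derivn_mulX scalerDr.
rewrite big_split /=; congr (_ + _).
  rewrite (@exp_deriv2E N.+1) ?mulr_suml; last by rewrite 2?ltnW.
  by apply: eq_bigr => k _; rewrite scalerAl.
rewrite big_ord_recl -[X in X + _]/(_ *: 0) scaler0 add0r.
rewrite (@exp_deriv2E N) ?leqnSn //.
rewrite raddf_sum scaler_sumr; apply: eq_bigr => k _ /=.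
rewrite /bump /= add1n doubleS derivZ -derivnS.
rewrite -[_ *+ k.*2.+2]scaler_nat !scalerA.
congr (_ *: _); rewrite factS natrM exprS -doubleS -mul2n natrM.
have h1 : 1 + k%:R != 0 :> R by rewrite nat1r pnatr_eq0.
have h2 : k`!%:R != 0 :> R by rewrite pnatr_eq0 -lt0n fact_gt0.
by field; rewrite h2 h1.
Qed.

Lemma exp_deriv2_lead s p : p != 0 ->
  exists2 r, exp_deriv2 s p = p + r & (size r < size p)%N.
Proof.
move=> p0; exists (\sum_(k < (size p).-1)
    (s ^+ k.+1 / k.+1`!%:R) *: p^`(k.+1.*2)).
  rewrite /exp_deriv2; case: (size p) (size_poly_gt0 p) => [|N]; rewrite p0 // => _.
  by rewrite big_ord_recl expr0 fact0 divr1 scale1r derivn0.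
rewrite (leq_ltn_trans (size_sum _ _ _)) //.
rewrite -(prednK (_ : 0 < size p)%N) ?size_poly_gt0 // ltnS.
apply/bigmax_leqP => k _; rewrite (leq_trans (size_scale_leq _ _)) //.
apply/leq_sizeP => j hj; rewrite coef_derivn nth_default ?mul0rn //.
by rewrite doubleS addSn (leq_trans (leqSpred _)) // ltnS (leq_trans hj) ?leq_addl.
Qed.

Lemma size_exp_deriv2 s p : size (exp_deriv2 s p) = size p.
Proof.
have [->|/(exp_deriv2_lead s) [r -> hr]] := eqVneq p 0; first by rewrite raddf0.
by rewrite size_polyDl.
Qed.

Lemma exp_deriv2_monic s p : p \is monic -> exp_deriv2 s p \is monic.
Proof.
move=> pm; have [r -> hr] := exp_deriv2_lead s (monic_neq0 pm).
by rewrite monicE lead_coefDl // -monicE.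
Qed.

Lemma coef_exp_deriv2 N s p d : (size p <= N)%N ->
  (exp_deriv2 s p)`_d =
  \sum_(k < N) s ^+ k / k`!%:R * ((k.*2 + d) ^_ k.*2)%:R * p`_(k.*2 + d).
Proof.
move=> hp; rewrite (exp_deriv2E s hp) coef_sum; apply: eq_bigr => k _.
by rewrite coefZ coef_derivn -[_ *+ _ ^_ _]mulr_natl mulrA.
Qed.

Lemma fconv_poly n p q : fconv n p q =
  \poly_(d < n.+1) ((-1) ^+ (n - d) * fconv_coef n p q (n - d)).
Proof.
rewrite poly_def /fconv (reindex_inj rev_ord_inj) /=; apply: eq_bigr => k _.
by rewrite !subSS subKn // -ltnS.
Qed.

(** Only even [j] survive, so the sign [(-1)^j] disappears. The at most one nonzero term is written
    as a sum over the exponential index, ready to be exchanged with the sums of the convolution. *)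
Lemma ecoef_hermite n s j : (j <= n)%N ->
  ecoef n (hermite n s) j =
  \sum_(k < n.+1 | k.*2 == j) (- (s / 2)) ^+ k / k`!%:R * (n ^_ j)%:R.
Proof.
move=> hj; rewrite /ecoef /hermite (@coef_exp_deriv2 n.+1) ?size_polyXn //.
rewrite mulr_sumr [RHS]big_mkcond /=; apply: eq_bigr => -[k hk] _ /=; rewrite coefXn.
have -> : ((k.*2 + (n - j))%N == n) = (k.*2 == j) by lia.
case: eqP => [e|]; last by rewrite !mulr0.
by rewrite e subnKC // -e /= !mulr1 -signr_odd odd_double mul1r.
Qed.

(** For [j = 2l], the weight [(n-i)! (n-j)! / (n! (n-k)!)] times the factor [n! / (n-j)!] of the
    Hermite coefficient leaves [(n-i)! / (n-k)!], the falling factorial from differentiating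
    [X^(n-i)] [2l] times. *)
Lemma fconv_hermite n s p : (size p <= n.+1)%N ->
  fconv n p (hermite n s) = exp_deriv2 (- (s / 2)) p.
Proof.
move=> hp; apply/polyP=> d; rewrite fconv_poly coef_poly.
rewrite (@coef_exp_deriv2 n.+1) //; set t := - (s / 2).
case: ltnP => hd; last first.
  rewrite big1 // => -[k hk] _ /=.
  by rewrite [p`__]nth_default ?mulr0 // (leq_trans hp) //; lia.
rewrite ltnS in hd.
(* The summand extended by 0 off its support, so that the two sides can be compared for each [l]
   separately. *)
pose F (l j i : 'I_n.+1) : R := if ((i + j)%N == (n - d)%N) && (l.*2 == j) then
  (-1) ^+ (n - d) * ((n - i)`!%:R * (n - j)`!%:R / (n`!%:R * (n - (n - d))`!%:R)
     * ecoef n p i * (t ^+ l / l`!%:R * (n ^_ j)%:R)) else 0.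
transitivity (\sum_l \sum_i \sum_j F l j i).
  rewrite exchange_big /fconv_coef mulr_sumr /=; apply: eq_bigr => i _.
  rewrite exchange_big mulr_sumr [LHS]big_mkcond /=; apply: eq_bigr => j _.
  case: eqP => hij; last by rewrite big1 // => l _; rewrite /F; case: andP => // -[/eqP].
  rewrite ecoef_hermite ?leq_ord // !mulr_sumr [LHS]big_mkcond /=; apply: eq_bigr => l _.
  by rewrite /F hij eqxx.
apply: eq_bigr => -[l ll] _ /=.
(* When [2l > n - d], no pair [(i, j)] contributes on the left, and on the right [p] has no
   coefficient of index [2l + d > n]. *)
have [hl|hl] := leqP l.*2 (n - d); last first.
  rewrite [p`__]nth_default ?mulr0; last by rewrite (leq_trans hp) //; lia.
  rewrite big1 // => -[i li] _; rewrite big1 // => -[j lj] _; rewrite /F /=.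
  by case: andP => // -[]; lia.
have hj : (l.*2 < n.+1)%N by lia.
have hi : (n - d - l.*2 < n.+1)%N by lia.
rewrite (bigD1 (Ordinal hi)) //= (bigD1 (Ordinal hj)) //=.
rewrite !big1 ?addr0; first last.
- move=> [j lj] /eqP hne; rewrite /F /=; case: andP => //= -[_ /eqP h].
  by case: hne; apply/val_inj => /=; lia.
- move=> [i li] /eqP hne; rewrite big1 // => -[j lj] _; rewrite /F /=.
  case: andP => //= -[/eqP h /eqP h'].
  by case: hne; apply/val_inj => /=; lia.
rewrite /F /= subnK // !eqxx /= /ecoef.
have -> : (n - (n - d - l.*2) = l.*2 + d)%N by lia.
have -> : (n - (n - d) = d)%N by lia.
have hsg : (-1) ^+ (n - d) * (-1) ^+ (n - d - l.*2) = 1 :> R.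
  rewrite -exprD -signr_odd.
  have -> : odd (n - d + (n - d - l.*2)) = false by lia.
  by [].
have hf : (n - l.*2)`!%:R * (n ^_ l.*2)%:R = n`!%:R :> R.
  by rewrite -natrM mulnC ffact_fact //; lia.
have hg : (l.*2 + d)`!%:R = ((l.*2 + d) ^_ l.*2)%:R * d`!%:R :> R.
  by rewrite -natrM -[in X in (_ * X`!)%:R](addKn l.*2 d) ffact_fact // leq_addr.
have n0 m : m`!%:R != 0 :> R by rewrite pnatr_eq0 -lt0n fact_gt0.
set x := p`__.
transitivity (((-1) ^+ (n - d) * (-1) ^+ (n - d - l.*2)) *
  ((n - l.*2)`!%:R * (n ^_ l.*2)%:R) * (l.*2 + d)`!%:R / n`!%:R / d`!%:R * x
  * (t ^+ l / l`!%:R)).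
  by field; rewrite !n0.
by rewrite hsg hf hg; field; rewrite !n0.
Qed.

End ExpDeriv2.

(** * Root vectors, Lagrange interpolation, roots from sign changes *)

Section RootVectors.
Variables (R : realType) (n : nat).
Implicit Types (w : 'rV[R]_n) (p f : {poly R}).

Definition increasing w := forall i j : 'I_n, (i < j)%N -> w 0 i < w 0 j.

(** Minus the partial derivative of [poly_of_roots w] in coordinate [i]; also the unnormalized
    Lagrange basis polynomial at the nodes [w]. *)
Definition cofactor_poly w (i : 'I_n) : {poly R} :=
  \prod_(j < n | j != i) ('X - (w 0 j)%:P).

Lemma increasing_inj w : increasing w -> injective (w 0).
Proof.
move=> hw i j hij; apply/val_inj; apply/eqP; rewrite eqn_leq.
by apply/andP; split; rewrite leqNgt; apply/negP => /hw; rewrite hij ltxx.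
Qed.

Lemma poly_of_roots_monic w : poly_of_roots w \is monic.
Proof. exact: monic_prod_XsubC. Qed.

Lemma poly_of_rootsE w : poly_of_roots w = \prod_(x <- codom (w 0)) ('X - x%:P).
Proof. by rewrite codomE big_map big_enum. Qed.

Lemma size_poly_of_roots w : size (poly_of_roots w) = n.+1.
Proof. by rewrite poly_of_rootsE size_prod_XsubC size_codom card_ord. Qed.

Lemma root_poly_of_roots w i : (poly_of_roots w).[w 0 i] = 0.
Proof.
by rewrite /poly_of_roots (bigD1 i) //= hornerM hornerXsubC subrr mul0r.
Qed.

Lemma poly_of_rootsD1 w i :
  poly_of_roots w = ('X - (w 0 i)%:P) * cofactor_poly w i.
Proof. by rewrite /poly_of_roots (bigD1 i). Qed.

Lemma cofactor_poly_monic w i : cofactor_poly w i \is monic.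
Proof. exact: monic_prod_XsubC. Qed.

Lemma size_cofactor_poly w i : size (cofactor_poly w i) = n.
Proof.
apply: succn_inj; rewrite -(size_poly_of_roots w) (poly_of_rootsD1 w i).
by rewrite size_monicM ?monicXsubC ?monic_neq0 ?cofactor_poly_monic ?size_XsubC.
Qed.

Lemma cofactor_poly_neq w i j : i != j -> (cofactor_poly w i).[w 0 j] = 0.
Proof.
move=> ij; rewrite /cofactor_poly (bigD1 j) 1?eq_sym //=.
by rewrite hornerM hornerXsubC subrr mul0r.
Qed.

Lemma deriv_poly_of_roots w i :
  (poly_of_roots w)^`().[w 0 i] = (cofactor_poly w i).[w 0 i].
Proof.
rewrite (poly_of_rootsD1 w i) derivM derivXsubC mul1r hornerD hornerM.
by rewrite hornerXsubC subrr mul0r addr0.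
Qed.

(** Of the factors [w_i - w_j], the negative ones are those with [j > i]; counting from 0, there are
    [n - i - 1] of them. *)
Lemma sgr_deriv_poly_of_roots w (i : 'I_n) : increasing w ->
  0 < (-1) ^+ (n - i.+1) * (poly_of_roots w)^`().[w 0 i].
Proof.
move=> hw; rewrite deriv_poly_of_roots horner_prod.
have -> : (-1) ^+ (n - i.+1) = \prod_(j < n | (i < j)%N) (-1) :> R.
  rewrite (reindex_inj rev_ord_inj) /= -[in LHS](card_ord (n - i.+1)) -prodr_const.
  rewrite (big_ord_widen n (fun=> -1)) ?leq_subr //; apply: eq_bigl => -[j hj] /=.
  by move: (ltn_ord i); lia.
rewrite [X in _ * X](bigID (fun j : 'I_n => (i < j)%N)) /= mulrA.
rewrite [X in _ * X * _](eq_bigl (fun j : 'I_n => (i < j)%N)); last first.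
  by move=> j; case: eqP => // ->; rewrite ltnn.
rewrite -big_split mulr_gt0 // prodr_gt0 // => j.
  by move=> /hw h; rewrite /= mulN1r hornerXsubC opprB subr_gt0.
rewrite -leqNgt => hj; suff /hw h : (j < i)%N by rewrite hornerXsubC subr_gt0.
by rewrite ltn_neqAle.
Qed.

Lemma deriv_poly_of_roots_neq0 w i : increasing w ->
  (poly_of_roots w)^`().[w 0 i] != 0.
Proof.
by move=> /(sgr_deriv_poly_of_roots i); apply: contraTneq => ->; rewrite mulr0 ltxx.
Qed.

Lemma eq0_on_roots w f : increasing w -> (size f <= n)%N ->
  (forall i, f.[w 0 i] = 0) -> f = 0.
Proof.
move=> hw hf h0; apply: (@roots_geq_poly_eq0 _ _ (codom (w 0))).
- by apply/allP => _ /codomP[i ->]; rewrite rootE h0.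
- by rewrite codomE map_inj_uniq ?enum_uniq //; exact: increasing_inj.
- by rewrite size_codom card_ord.
Qed.

Lemma lagrange_interpolation w f : increasing w -> (size f <= n)%N ->
  f = \sum_i (f.[w 0 i] / (poly_of_roots w)^`().[w 0 i]) *: cofactor_poly w i.
Proof.
move=> hw hf; apply/subr0_eq/(eq0_on_roots hw).
  rewrite (leq_trans (size_polyD _ _)) // geq_max hf size_polyN.
  rewrite (leq_trans (size_sum _ _ _)) //; apply/bigmax_leqP => i _.
  by rewrite (leq_trans (size_scale_leq _ _)) // size_cofactor_poly.
move=> j; rewrite hornerD hornerN horner_sum (bigD1 j) //= big1 ?addr0.
  rewrite hornerZ -deriv_poly_of_roots divfK ?subrr //.
  exact: deriv_poly_of_roots_neq0.
by move=> i ij; rewrite hornerZ cofactor_poly_neq ?mulr0.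
Qed.

Lemma lagrange_lead_coef w f : increasing w -> (size f <= n)%N ->
  \sum_i f.[w 0 i] / (poly_of_roots w)^`().[w 0 i] = f`_n.-1.
Proof.
move=> hw hf; rewrite [in RHS](lagrange_interpolation hw hf) coef_sum.
apply: eq_bigr => i _; rewrite coefZ.
by move: (cofactor_poly_monic w i); rewrite monicE lead_coefE size_cofactor_poly
  => /eqP ->; rewrite mulr1.
Qed.

Lemma root_vec_poly_of_roots w :
  (forall i j : 'I_n, (i <= j)%N -> w 0 i <= w 0 j) ->
  root_vec n (poly_of_roots w) = w.
Proof.
move=> hw; rewrite /root_vec; set P := [set _ | _]%classic.
have [hs hp] : P (xget 0 P) by apply: xgetPex; exists w.
move: (xget _ _) hs hp => v hv hp.
have srt u : (forall i j : 'I_n, (i <= j)%N -> u 0 i <= u 0 j) ->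
    sorted <=%R (codom (u 0)).
  move=> hu; rewrite codomE; apply: (@homo_sorted _ _ _ (fun i j : 'I_n => (i <= j)%N)).
    exact: hu.
  by have := iota_sorted 0 n; rewrite -val_enum_ord sorted_map.
have : codom (v 0) = codom (w 0).
  apply: (sorted_eq le_trans le_anti); [exact: srt|exact: srt|].
  by apply: prod_XsubC_eq; rewrite -!poly_of_rootsE.
by rewrite !codomE => /eq_in_map h; apply/rowP => i; apply: h; rewrite mem_enum.
Qed.

Lemma root_vec_increasing w : increasing w ->
  root_vec n (poly_of_roots w) = w.
Proof.
move=> hw; apply: root_vec_poly_of_roots => i j; rewrite leq_eqVlt.
by case/orP => [/eqP/val_inj -> // | /hw/ltW].
Qed.

(** Each interval contains a root by the intermediate value theorem; these are distinct, and [n]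
    distinct roots exhaust a monic polynomial of degree [n]. Used for Hermite polynomials and for
    perturbed ones alike. *)
Lemma roots_of_sign_changes (l u : 'I_n -> R) p :
  (forall i, l i <= u i) -> (forall i j : 'I_n, (i < j)%N -> u i <= l j) ->
  (forall i, p.[l i] * p.[u i] < 0) -> p \is monic -> size p = n.+1 ->
  exists w, [/\ forall i, l i < w 0 i < u i, increasing w & poly_of_roots w = p].
Proof.
move=> hlu hul hp pm sp.
have /choice[v hv] : forall i, exists x, (l i < x < u i) /\ root p x.
  move=> i; wlog : p {pm sp} hp / p.[l i] <= 0.
    move=> H; have [|h] := lerP p.[l i] 0; first exact: H.
    have h1 j : (- p).[l j] * (- p).[u j] < 0 by rewrite !hornerN mulrNN.
    have h2 : (- p).[l i] <= 0 by rewrite hornerN oppr_le0 ltW.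
    by have [x [hx rx]] := H _ h1 h2; exists x; rewrite -rootN.
  move=> h0; have hl : p.[l i] < 0.
    by rewrite lt_neqAle h0 andbT; apply: contraTneq (hp i) => ->; rewrite mul0r ltxx.
  have hu : 0 < p.[u i] by have := hp i; rewrite nmulr_rlt0.
  have [|x /andP[x1 x2] rx] := @poly_ivt R p (l i) (u i) (hlu i).
    by rewrite h0 ltW.
  exists x; split => //; rewrite !lt_neqAle x1 x2 !andbT; apply/andP; split.
    by apply: contraTneq rx => <-; rewrite rootE lt_eqF.
  by apply: contraTneq rx => ->; rewrite rootE gt_eqF.
pose w : 'rV[R]_n := \row_i v i.
have hw : increasing w.
  move=> i j ij; rewrite !mxE (lt_trans (_ : _ < u i)) //.
    by case: (hv i) => /andP[].
  by rewrite (le_lt_trans (hul _ _ ij)) //; case: (hv j) => /andP[].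
exists w; split => //; first by move=> i; rewrite mxE; case: (hv i).
rewrite poly_of_rootsE [RHS](@all_roots_prod_XsubC _ p (codom (w 0))).
- by rewrite (monicP pm) scale1r.
- by rewrite size_codom card_ord.
- by apply/allP => _ /codomP[i ->]; rewrite mxE; case: (hv i).
- rewrite uniq_rootsE codomE map_inj_uniq ?enum_uniq //; exact: increasing_inj.
Qed.

End RootVectors.

Lemma size_monicB (R : nzRingType) (p q : {poly R}) n :
  p \is monic -> q \is monic -> size p = n.+1 -> size q = n.+1 ->
  (size (p - q)%R <= n)%N.
Proof.
move=> /monicP pm /monicP qm sp sq; apply/leq_sizeP => j.
rewrite leq_eqVlt coefB => /orP[/eqP <-|hj].
  by rewrite -[n]/(n.+1.-1) -{1}sp -sq -!lead_coefE pm qm subrr.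
by rewrite !nth_default ?subrr ?sp ?sq.
Qed.

(** * Hermite polynomials: recurrences, scaling, real-rootedness *)

Section HermitePolynomials.
Variable R : realType.
Implicit Types (n m k : nat) (tau sigma : R).

Lemma size_hermite n tau : size (hermite n tau) = n.+1.
Proof. by rewrite size_exp_deriv2 size_polyXn. Qed.

Lemma hermite_monic n tau : hermite n tau \is monic.
Proof. exact/exp_deriv2_monic/monicXn. Qed.

Lemma hermite0 tau : hermite 0 tau = 1.
Proof.
by rewrite /hermite (@exp_deriv2E _ 1) ?size_polyXn // big_ord1 derivn0 expr0
  fact0 divr1 scale1r.
Qed.

Lemma hermiteS n tau :
  hermite n.+1 tau = hermite n tau * 'X - tau *: (hermite n tau)^`().
Proof.
rewrite /hermite exprSr exp_deriv2_mulX; congr (_ + _).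
by rewrite mulrN mulrC divfK ?scaleNr // pnatr_eq0.
Qed.

Lemma deriv_hermite n tau :
  (hermite n tau)^`() = n%:R *: hermite n.-1 tau.
Proof. by rewrite /hermite -exp_deriv2_deriv derivXn -[_ *+ n]scaler_nat linearZ. Qed.

Lemma derivn_hermite n m tau :
  (hermite n tau)^`(m) = (n ^_ m)%:R *: hermite (n - m) tau.
Proof.
elim: m => [|m IHm]; first by rewrite derivn0 ffactn0 scale1r subn0.
by rewrite derivnS IHm derivZ deriv_hermite scalerA -natrM -ffactnSr subnS.
Qed.

Lemma hermiteSS n tau :
  hermite n.+1 tau = hermite n tau * 'X - (tau * n%:R) *: hermite n.-1 tau.
Proof. by rewrite hermiteS deriv_hermite scalerA. Qed.

(** The semigroup law of [exp(s D^2)] on [X^n]: the operator commutes with [D], and its commutator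
    with [X] adds [- sigma D] to the term [- tau D] of [hermiteS]. *)
Lemma exp_deriv2_hermite n tau sigma :
  exp_deriv2 (- (sigma / 2)) (hermite n tau) = hermite n (tau + sigma).
Proof.
elim: n => [|n IHn].
  by rewrite !hermite0 (@exp_deriv2E _ 1) ?size_poly1 // big_ord1 derivn0 expr0
    fact0 divr1 scale1r.
rewrite !hermiteS raddfB /= [exp_deriv2 _ (_ *: _)]linearZ /=.
rewrite exp_deriv2_deriv exp_deriv2_mulX IHn.
have -> : 2 * - (sigma / 2) = - sigma by field.
by rewrite scaleNr scalerDl opprD addrA addrAC.
Qed.

Lemma horner_hermite_scale n c tau x :
  (hermite n (c ^+ 2 * tau)).[c * x] = c ^+ n * (hermite n tau).[x].
Proof.
elim/ltn_ind: n => -[_|n IHn]; first by rewrite !hermite0 !hornerC mulr1.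
rewrite !hermiteSS !hornerD !hornerN !hornerMX !hornerZ IHn //.
(* Split off because [n.-1] truncates at 0: the powers of [c] no longer match there, but the
   coefficient [tau * 0] vanishes. *)
case: n IHn => [|n] IHn; first by rewrite !hermite0 !hornerC; ring.
by rewrite IHn //= !exprS; ring.
Qed.

Lemma hermiteN n tau x : (hermite n tau).[- x] = (-1) ^+ n * (hermite n tau).[x].
Proof. by rewrite -horner_hermite_scale sqrrN expr1n mul1r mulN1r. Qed.

Lemma monic_pos_at_infinity (p : {poly R}) (b : R) : p \is monic ->
  exists2 x, b < x & 0 < p.[x].
Proof.
move=> pm; have [|x hx] := @polyrcf.poly_pinfty_gt_lc R p.
  by rewrite (monicP pm).
exists (Num.max x b + 1).
  by rewrite (le_lt_trans (_ : _ <= Num.max x b)) ?le_max ?lexx ?orbT // ltrDl.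
by rewrite (lt_le_trans _ (hx _ _)) ?(monicP pm) // ler_wpDr // le_max lexx.
Qed.

(* Since [hermite n.+1 tau] equals [- tau *: (hermite n tau)^`()] at the roots of
   [hermite n tau], it alternates in sign along [-B], these roots, and [B]. *)
Lemma hermite_real_rooted n tau : 0 < tau ->
  exists w : 'rV[R]_n, increasing w /\ poly_of_roots w = hermite n tau.
Proof.
move=> tau0; elim: n => [|n [w [hw wE]]].
  by exists 0; split; [case | rewrite hermite0 /poly_of_roots big_ord0].
set p := hermite n.+1 tau.
have [B hB pB] := monic_pos_at_infinity (\sum_i `|w 0 i|) (hermite_monic n.+1 tau).
have wB i : `|w 0 i| < B.
  by rewrite (le_lt_trans _ hB) // (bigD1 i) //= lerDl sumr_ge0.
have B0 : 0 < B by rewrite (le_lt_trans _ hB) // sumr_ge0.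
(* [- B], then the [n] roots, then [B] for ever: [insub j] fails for [j >= n], so [t] is monotone on
   all of [nat]. *)
pose t k := if k is j.+1 then if insub j is Some i then w 0 i else B else - B.
have tw k (hk : (k < n)%N) : t k.+1 = w 0 (Ordinal hk) by rewrite /t insubT.
have tB k : (n <= k)%N -> t k.+1 = B.
  by rewrite /t => hk; case: insubP => // i; rewrite ltnNge hk.
have t_ndecr : {homo t : i j / (i <= j)%N >-> i <= j}.
  apply: homo_leq => [x|y x z|[|k]]; [exact: lexx|exact: le_trans| |].
    have [hn|hn] := leqP n 0; first by rewrite tB //= ltW // gtrN.
    by rewrite (tw _ hn) ltW //=; have := wB (Ordinal hn); rewrite ltr_norml => /andP[].
  have [hk|hk] := leqP n k; first by rewrite !tB // (leq_trans hk).
  rewrite (tw _ hk); have [hk'|hk'] := leqP n k.+1.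
    by rewrite tB // ltW // (le_lt_trans (ler_norm _)).
  by rewrite (tw _ hk') ltW // hw.
have t_sgr k : (k <= n.+1)%N -> 0 < (-1) ^+ (n.+1 - k) * p.[t k].
  case: k => [_|k]; first by rewrite subn0 hermiteN mulrA -expr2 sqrr_sign mul1r.
  rewrite ltnS leq_eqVlt => /orP[/eqP ->|hk].
    by rewrite tB // subnn mul1r.
  rewrite (tw _ hk) /p hermiteS hornerD hornerMX hornerN hornerZ -wE.
  rewrite root_poly_of_roots mul0r add0r subSS -[(n - k)%N]prednK ?subn_gt0 // -subnS.
  rewrite exprS mulN1r mulrNN mulrCA mulr_gt0 //.
  exact: (sgr_deriv_poly_of_roots (Ordinal hk) hw).
have [] := @roots_of_sign_changes R n.+1 (fun i => t i) (fun i => t i.+1) p.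
- by move=> i; apply: t_ndecr.
- by move=> i j ij; apply: t_ndecr.
- move=> i; have := mulr_gt0 (t_sgr i (ltnW (ltn_ord i))) (t_sgr i.+1 (ltn_ord i)).
  rewrite subSS subSn -1?ltnS // exprS mulN1r mulrACA mulNr -expr2 sqrr_sign mulN1r.
  by rewrite oppr_gt0.
- exact: hermite_monic.
- exact: size_hermite.
- by move=> v [_ hv vE]; exists v.
Qed.

Lemma hermite_rootsP n tau : 0 < tau ->
  increasing (hermite_roots n tau) /\
  poly_of_roots (hermite_roots n tau) = hermite n tau.
Proof.
move=> /(hermite_real_rooted n)[w [hw wE]].
by rewrite /hermite_roots -wE root_vec_increasing.
Qed.

Lemma hermite_roots_scale n c tau : 0 < c -> 0 < tau ->
  hermite_roots n (c ^+ 2 * tau) = c *: hermite_roots n tau.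
Proof.
move=> c0 tau0; have [hw wE] := hermite_rootsP n tau0.
set w := hermite_roots n tau in hw wE *.
have hcw : increasing (c *: w) by move=> i j /hw; rewrite !mxE ltr_pM2l.
rewrite -[RHS](root_vec_increasing hcw); congr root_vec.
have e0 : 0 < c ^+ 2 * tau by rewrite mulr_gt0 // exprn_gt0.
have [hv vE] := hermite_rootsP n e0.
apply/subr0_eq/(eq0_on_roots hcw).
  by apply: size_monicB; rewrite ?hermite_monic ?poly_of_roots_monic
    ?size_hermite ?size_poly_of_roots.
move=> i; rewrite hornerD hornerN root_poly_of_roots mxE horner_hermite_scale.
by rewrite -wE root_poly_of_roots mulr0 subrr.
Qed.

Lemma hermite_vecE n m tau : 0 < tau -> (m <= n)%N -> forall i,
  hermite_vec n m tau i 0 = - ((n ^_ m)%:R / n%:R) *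
    ((hermite (n - m) tau).[hermite_roots n tau 0 i] /
     (hermite n.-1 tau).[hermite_roots n tau 0 i]).
Proof.
move=> tau0 hm i; rewrite mxE derivn_hermite deriv_hermite !hornerZ.
by rewrite invfM mulrACA mulNr.
Qed.

End HermitePolynomials.

(** * The vectors [v^(m, tau)] and discrete orthogonality *)

Section HermiteVectors.
Variables (R : realType) (n : nat) (tau : R).
Hypotheses (n_gt0 : (0 < n)%N) (tau_gt0 : 0 < tau).
Local Notation h := (hermite_roots n tau).
Local Notation H k := (hermite k tau).

Lemma deriv_hermite_roots_neq0 i : (H n)^`().[h 0 i] != 0.
Proof.
have [hw wE] := hermite_rootsP n tau_gt0.
by rewrite -wE deriv_poly_of_roots_neq0.
Qed.

Lemma hermite_pred_roots_neq0 i : (H n.-1).[h 0 i] != 0.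
Proof.
have := deriv_hermite_roots_neq0 i; rewrite deriv_hermite hornerZ.
by rewrite mulf_eq0 negb_or => /andP[].
Qed.

(* The weights [1 / H_(n-1)(h_i)^2] are, up to a factor, those of Gauss-Hermite
   quadrature. The case [l = n - 1] is Lagrange interpolation, and symmetry of
   the multiplication by [X] carries orthogonality down from [l + 1, l + 2]. *)
Lemma hermite_discrete_orthogonality k l : (k < l)%N -> (l <= n)%N ->
  \sum_i (H k).[h 0 i] * (H l).[h 0 i] / (H n.-1).[h 0 i] ^+ 2 = 0.
Proof.
have [hw wE] := hermite_rootsP n tau_gt0.
move=> + hl; have -> : l = (n - (n - l))%N by rewrite subKn.
have : (n - l <= n)%N by rewrite leq_subr.
move: (n - l)%N => d {l hl}; elim/ltn_ind: d k => -[_|[_|d IHd]] k hd hk.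
- rewrite big1 // => i _; rewrite subn0 -[X in _ * X.[_] / _]wE.
  by rewrite root_poly_of_roots mulr0 mul0r.
- rewrite subn1 in hk *.
  transitivity (n%:R * \sum_i (H k).[h 0 i] / (poly_of_roots h)^`().[h 0 i]).
    rewrite mulr_sumr; apply: eq_bigr => i _; rewrite wE deriv_hermite hornerZ.
    have h1 := hermite_pred_roots_neq0 i.
    have h2 : n%:R != 0 :> R by rewrite pnatr_eq0 -lt0n.
    by field; rewrite h1 h2.
  rewrite (lagrange_lead_coef hw) ?size_hermite; last by lia.
  by rewrite nth_default ?mulr0 ?size_hermite.
pose L := (n - d.+1)%N; have eL : (n - d.+2)%N = L.-1 by rewrite /L; lia.
have L0 : (0 < L)%N by rewrite /L; lia.
rewrite eL in hk *.
have tL0 : tau * L%:R != 0 by rewrite mulf_neq0 ?gt_eqF ?ltr0n.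
apply: (mulfI tL0); rewrite mulr0.
have e1 := IHd d.+1 (leqnn _) k.+1 ltac:(lia) ltac:(lia).
have e2 := IHd d.+1 (leqnn _) k.-1 ltac:(lia) ltac:(lia).
have e3 := IHd d (leqnSn _) k ltac:(lia) ltac:(lia).
have eL' : (n - d)%N = L.+1 by rewrite /L; lia.
rewrite -/L in e1 e2; rewrite eL' in e3.
(* The identity [tau L H_k H_(L-1) = H_(k+1) H_L + tau k H_(k-1) H_L - H_k H_(L+1)] comes from the
   recurrence for [H_L] and for [H_k]. At [k = 0] the truncated [k.-1] is harmless, its coefficient
   being 0. *)
transitivity (0 + (tau * k%:R) * 0 - 0 : R); last by rewrite mulr0 subr0 addr0.
rewrite -[in X in X + _ - _]e1 -[in X in _ + _ * X - _]e2 -[in X in _ - X]e3.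
rewrite !mulr_sumr -sumrN -!big_split /=; apply: eq_bigr => i _.
rewrite !hermiteSS !hornerD !hornerN !hornerMX !hornerZ.
by field; exact: hermite_pred_roots_neq0.
Qed.

(** On the nodes, [v^(m, tau)] is a multiple of [H_(n-m) / H_(n-1)], so the Euclidean product is a
    weighted sum of [H_(n-m) H_(n-m')]. *)
Lemma hermite_vec_orthogonal m m' : (1 <= m <= n)%N -> (1 <= m' <= n)%N ->
  m != m' -> dotv (hermite_vec n m tau) (hermite_vec n m' tau) = 0.
Proof.
have dC u v : dotv u v = dotv v u :> R.
  by apply: eq_bigr => i _; rewrite mulrC.
wlog lt_m : m m' / (m' < m)%N.
  move=> W hm hm' ne; case: (ltngtP m' m) => [lt|lt|e]; first exact: W.
    by rewrite dC W // eq_sym.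
  by rewrite e eqxx in ne.
move=> hm hm' _.
transitivity ((- ((n ^_ m)%:R / n%:R)) * (- ((n ^_ m')%:R / n%:R)) *
  \sum_i (H (n - m)).[h 0 i] * (H (n - m')).[h 0 i] / (H n.-1).[h 0 i] ^+ 2).
  rewrite mulr_sumr; apply: eq_bigr => i _.
  rewrite !hermite_vecE //; [|lia|lia].
  have h1 := hermite_pred_roots_neq0 i.
  have h2 : n%:R != 0 :> R by rewrite pnatr_eq0 -lt0n.
  by field; rewrite h1 h2.
by rewrite hermite_discrete_orthogonality ?mulr0 //; lia.
Qed.

Lemma hermite_vec_neq0 m : (1 <= m <= n)%N -> hermite_vec n m tau != 0.
Proof.
move=> hm; have [hw wE] := hermite_rootsP n tau_gt0.
apply/eqP => v0; have : (H n)^`(m) = 0.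
  apply: (eq0_on_roots hw) => [|i].
    rewrite derivn_hermite (leq_trans (size_scale_leq _ _)) // size_hermite; lia.
  move/colP/(_ i): v0; rewrite !mxE => /eqP; rewrite oppr_eq0 mulf_eq0 invr_eq0.
  by rewrite (negPf (deriv_hermite_roots_neq0 i)) orbF => /eqP.
move/eqP; rewrite derivn_hermite scaler_eq0 pnatr_eq0.
rewrite (negPf (monic_neq0 (hermite_monic _ _))) orbF eqn0Ngt ffact_gt0.
by case/andP: hm => _ ->.
Qed.

(** This identifies [orth_ones] with the orthogonal complement of the first eigenvector. *)
Lemma hermite_vec1 : hermite_vec n 1 tau = - const_mx 1.
Proof.
apply/colP => i; rewrite !mxE derivn1 divff //.
exact: deriv_hermite_roots_neq0.
Qed.

(** Numerator and denominator in [hermite_vecE] scale by [c^(n-m)] and [c^(n-1)]. *)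
Lemma hermite_vec_scale c m : 0 < c -> (1 <= m <= n)%N ->
  hermite_vec n m (c ^+ 2 * tau) = c ^- m.-1 *: hermite_vec n m tau.
Proof.
move=> c0 hm; apply/colP => i; rewrite [RHS]mxE.
have t0 : 0 < c ^+ 2 * tau by rewrite mulr_gt0 // exprn_gt0.
rewrite !hermite_vecE //; [|lia|lia].
rewrite (hermite_roots_scale n c0 tau_gt0) (_ : (c *: h) 0 i = c * h 0 i) ?mxE //.
rewrite !horner_hermite_scale.
have -> : n.-1 = (n - m + m.-1)%N by lia.
rewrite exprD; have -> : (n - m + m.-1)%N = n.-1 by lia.
have h1 := hermite_pred_roots_neq0 i.
have h2 : n%:R != 0 :> R by rewrite pnatr_eq0 -lt0n.
have h3 k : c ^+ k != 0 by rewrite expf_neq0 // gt_eqF.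
by field; rewrite h1 h2 !h3.
Qed.

End HermiteVectors.

(** * Derivatives of maps between row vectors *)

Section RowVectorNorm.
Local Open Scope classical_set_scope.
Variables (R : realType) (n : nat).

Lemma rV_norm_leP (x : 'rV[R]_n) (b : R) : 0 <= b ->
  (forall i, `|x 0 i| <= b) <-> `|x| <= b.
Proof.
move=> b0; rewrite -[`|x|]/(mx_norm x) mx_normrE; split=> [h|].
  by apply/bigmax_leP; split => // -[i j] _ /=; rewrite ord1.
by move=> /bigmax_leP[_ h] i; exact: (h (0, i)).
Qed.

Lemma ler_norm_mulmx (x : 'rV[R]_n) (M : 'M[R]_n) (b : R) : 0 <= b ->
  (forall i j, `|M i j| <= b) -> `|x *m M| <= n%:R * b * `|x|.
Proof.
move=> b0 hM; apply/rV_norm_leP => [|j]; first by rewrite !mulr_ge0.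
rewrite mxE (le_trans (ler_norm_sum _ _ _)) //.
rewrite -mulrA mulr_natl -[X in _ *+ X](card_ord n) -sumr_const ler_sum // => i _.
by rewrite normrM mulrC ler_pM //; exact: (rV_norm_leP _ _).2.
Qed.

Lemma mulmxr_continuous (M : 'M[R]_n) :
  continuous (mulmxr M : 'rV[R]_n -> 'rV[R]_n).
Proof.
apply: bounded_linear_continuous; apply/linear_boundedP.
pose b := \sum_i \sum_j `|M i j|.
exists (n%:R * b); split; first exact: num_real.
have b0 : 0 <= b by rewrite sumr_ge0 // => i _; rewrite sumr_ge0.
have hb i j : `|M i j| <= b.
  rewrite /b (bigD1 i) //= (bigD1 j) //= -addrA lerDl addr_ge0 ?sumr_ge0 //.
  by move=> k _; rewrite sumr_ge0.
move=> r hr x; rewrite (le_trans (ler_norm_mulmx _ b0 hb)) //.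
by rewrite ler_wpM2r // ltW.
Qed.

(** Caratheodory's criterion: the error [f x - f a - (x - a) C(a)] equals [(x - a) (C(x) - C(a))],
    which is [o(x - a)] by continuity of [C] at [a]. *)
Lemma jacobian_caratheodory (f : 'rV[R]_n -> 'rV[R]_n) (C : 'rV[R]_n -> 'M[R]_n)
    (a : 'rV[R]_n) :
  (\forall x \near a, f x - f a = (x - a) *m C x) ->
  (forall i j, (fun x => C x i j) @ a --> C a i j) ->
  jacobian f a = C a.
Proof.
move=> hf hC; suff h : 'd f a = mulmxr (C a) :> ('rV[R]_n -> 'rV[R]_n).
  by rewrite /jacobian h; apply/row_matrixP => i; rewrite !rowE mul_rV_lin1.
apply: diff_unique; first exact: mulmxr_continuous.
apply/eqaddoP => e e0.
(* A matrix with entries at most this bound multiplies the sup norm by at most [n e / (n + 1)]; the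
   denominator stays nonzero for [n = 0]. *)
have e1 : 0 < e / n.+1%:R by rewrite divr_gt0.
have hC' : \forall x \near a, forall i j, `|C a i j - C x i j| < e / n.+1%:R.
  have FF : Filter (nbhs a) by exact: nbhs_filter.
  apply: (@filter_forall _ _
    (fun i x => forall j, `|C a i j - C x i j| < e / n.+1%:R) (nbhs a) FF) => i.
  apply: (@filter_forall _ _ (fun j x => `|C a i j - C x i j| < e / n.+1%:R) _ FF) => j.
  exact: ((cvgrPdist_lt _ _).1 (hC i j)).
have : \forall x \near a, `|f x - f a - (x - a) *m C a| <= e * `|x - a|.
  near=> x.
  have -> : f x - f a = (x - a) *m C x by near: x.
  rewrite -mulmxBr (le_trans (ler_norm_mulmx _ (ltW e1) _)) //.
    move=> i j; rewrite !mxE distrC ltW //.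
    by move: i j; near: x; exact: hC'.
  rewrite ler_wpM2r // mulrCA -[leRHS]mulr1 ler_pM2l //.
  by rewrite ler_pdivrMr // mul1r ler_nat.
rewrite (near_shift 0 a) subr0; apply: filterS => h /=.
by rewrite /shift addrK opprD addrA.
Unshelve. all: by end_near. Qed.

End RowVectorNorm.

(** * Convergence of families of polynomials *)

Section PolynomialFamilies.
Local Open Scope classical_set_scope.
Variables (R : realType) (T : topologicalType) (a : T).
Implicit Types (p q : T -> {poly R}) (x : T -> R).

(** Convergence is taken coefficient by coefficient; a uniform bound on the sizes then turns
    evaluation and [exp_deriv2] into sums of fixed length, continuous term by term. *)
Definition poly_cvg p := forall k, (fun t => (p t)`_k) @ a --> (p a)`_k.

Lemma cvg_sumr (I : Type) (r : seq I) (P : pred I) (F : I -> T -> R) (l : I -> R) :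
  (forall i, P i -> F i @ a --> l i) ->
  (fun t => \sum_(i <- r | P i) F i t) @ a --> \sum_(i <- r | P i) l i.
Proof. by move=> h; apply: cvg_big => //; exact: add_continuous. Qed.

Lemma poly_cvgM p q : poly_cvg p -> poly_cvg q -> poly_cvg (fun t => p t * q t).
Proof.
move=> hp hq k; rewrite coefM (_ : (fun _ => _) =
  fun t => \sum_(j < k.+1) (p t)`_j * (q t)`_(k - j)); last first.
  by apply/funext => t; rewrite coefM.
by apply: cvg_sumr => j _; apply: cvgM; [exact: hp | exact: hq].
Qed.

Lemma poly_cvg_prod (I : Type) (r : seq I) (P : pred I) (F : I -> T -> {poly R}) :
  (forall i, P i -> poly_cvg (F i)) ->
  poly_cvg (fun t => \prod_(i <- r | P i) F i t).
Proof.
move=> hF; elim: r => [|i r IHr].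
  by move=> k; under eq_fun do rewrite big_nil; rewrite big_nil; exact: cvg_cst.
rewrite (_ : (fun t => _) = fun t =>
  (if P i then F i t else 1) * \prod_(j <- r | P j) F j t); last first.
  by apply/funext => t; rewrite big_cons; case: ifP; rewrite ?mul1r.
apply: poly_cvgM => //; case: (boolP (P i)) => [/hF //|_] k; exact: cvg_cst.
Qed.

Lemma poly_cvg_XsubC x : x @ a --> x a -> poly_cvg (fun t => 'X - (x t)%:P).
Proof.
move=> hx k; rewrite coefB coefC.
rewrite (_ : (fun _ => _) = fun t => 'X`_k - (if k == 0 then x t else 0)); last first.
  by apply/funext => t; rewrite coefB coefC.
by apply: cvgB; first exact: cvg_cst; case: eqP => _ //; exact: cvg_cst.
Qed.

Lemma poly_cvg_exp_deriv2 s N p : (forall t, (size (p t) <= N)%N) ->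
  poly_cvg p -> poly_cvg (fun t => exp_deriv2 s (p t)).
Proof.
move=> sp hp k; rewrite (coef_exp_deriv2 _ _ (sp a)).
rewrite (_ : (fun _ => _) = fun t => \sum_(j < N)
  s ^+ j / j`!%:R * ((j.*2 + k) ^_ j.*2)%:R * (p t)`_(j.*2 + k)); last first.
  by apply/funext => t; rewrite (coef_exp_deriv2 _ _ (sp t)).
by apply: cvg_sumr => j _; apply: cvgM; [exact: cvg_cst | exact: hp].
Qed.

Lemma cvg_horner N p x : (forall t, (size (p t) <= N)%N) -> poly_cvg p ->
  x @ a --> x a -> (fun t => (p t).[x t]) @ a --> (p a).[x a].
Proof.
move=> sp hp hx; rewrite (horner_coef_wide _ (sp a)).
rewrite (_ : (fun _ => _) = fun t => \sum_(j < N) (p t)`_j * x t ^+ j); last first.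
  by apply/funext => t; rewrite (horner_coef_wide _ (sp t)).
apply: cvg_sumr => -[j /= _] _; apply: cvgM; first exact: hp.
elim: j => [|j IHj]; first exact: cvg_cst.
rewrite exprS (_ : (fun _ => _) = fun t => x t * x t ^+ j); first exact: cvgM.
by apply/funext => t; rewrite exprS.
Qed.

End PolynomialFamilies.

(** * Continuity of simple roots *)

Section RootPerturbation.
Local Open Scope classical_set_scope.
Variables (R : realType) (T : topologicalType) (n : nat) (a : T).
Variables (p : T -> {poly R}) (w : 'rV[R]_n).
Hypotheses (p_monic : forall t, p t \is monic) (size_p : forall t, size (p t) = n.+1).
Hypotheses (p_cvg : poly_cvg a p) (w_incr : increasing w).
Hypothesis (wE : poly_of_roots w = p a).

(** Around each simple root [w_i], [p a] changes sign across a small window. Strict inequalities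
    persist for [t] near [a], so [p t] has one root in each window; in particular [root_vec] is not
    the dummy there. *)
Lemma near_root_vec_dist (e : R) : 0 < e ->
  \forall t \near a, poly_of_roots (root_vec n (p t)) = p t /\
    forall i, `|w 0 i - root_vec n (p t) 0 i| < e.
Proof.
move=> e0.
(* The smallest gap between roots, or 1 if that is smaller or there is no pair. *)
pose g := \big[Num.min/1]_(ij : 'I_n * 'I_n | ij.1 != ij.2) `|w 0 ij.1 - w 0 ij.2|.
have g0 : 0 < g.
  apply: lt_bigmin => // -[i j] /= ij; rewrite normr_gt0 subr_eq0.
  by apply: contra ij => /eqP /(increasing_inj w_incr) ->.
have gle i j : i != j -> g <= `|w 0 i - w 0 j|.
  by move=> ij; exact: (@bigmin_le_cond _ _ _ _ (i, j)).
(* [2 d <= g] keeps the windows from overlapping and the other roots outside. Across window [i] the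
   factor [X - w_i] contributes [- d * d], and the other factors keep their sign. *)
pose d := Num.min e (g / 2).
have d0 : 0 < d by rewrite lt_min e0 divr_gt0.
have de : d <= e by rewrite ge_min lexx.
have dg : d + d <= g.
  by rewrite -mulr2n -mulr_natr -ler_pdivlMr // ge_min lexx orbT.
have sgn i : (p a).[w 0 i - d] * (p a).[w 0 i + d] < 0.
  rewrite -wE (poly_of_rootsD1 w i) !hornerM !hornerXsubC addrAC subrr add0r.
  rewrite (addrC (w 0 i) d) addrK mulrACA mulNr pmulr_llt0; last first.
    rewrite !horner_prod -big_split prodr_gt0 // => j ji /=.
    rewrite !hornerXsubC; move: (gle _ _ ji) dg d0.
    by case: (ltrP (w 0 j) (w 0 i)) => h; nra.
  by rewrite oppr_lt0 mulr_gt0.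
have : \forall t \near a, forall i, (p t).[w 0 i - d] * (p t).[w 0 i + d] < 0.
  apply: (@filter_forall _ _ (fun i t => (p t).[w 0 i - d] * (p t).[w 0 i + d] < 0)
    (nbhs a) (nbhs_filter a)) => i.
  have sz t : (size (p t) <= n.+1)%N by rewrite size_p.
  have hc : (fun t => (p t).[w 0 i - d] * (p t).[w 0 i + d]) @ a -->
      (p a).[w 0 i - d] * (p a).[w 0 i + d].
    by apply: cvgM; apply: (cvg_horner sz p_cvg); exact: cvg_cst.
  exact: (cvgr_lt _ hc _ (sgn i)).
apply: filterS => t ht.
have [||v [hv v_incr vE]] := roots_of_sign_changes _ _ ht (p_monic t) (size_p t).
- by move=> i; rewrite lerD2l ge0_cp // ltW.
- move=> i j ij; have := w_incr ij; have : j != i by rewrite neq_ltn ij orbT.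
  by move=> /gle; case: ger0P; lra.
rewrite -vE (root_vec_increasing v_incr); split=> // i.
rewrite distrC (lt_le_trans _ de) // ltr_distl.
by have := hv i.
Qed.

Lemma root_vec_cvg i : (fun t => root_vec n (p t) 0 i) @ a --> w 0 i.
Proof.
apply/cvgrPdist_lt => e e0; apply: filterS (near_root_vec_dist e0) => t [_]; exact.
Qed.

Lemma near_root_vec : \forall t \near a, poly_of_roots (root_vec n (p t)) = p t.
Proof. by apply: filterS (near_root_vec_dist ltr01) => t []. Qed.

End RootPerturbation.

(** * Jacobian of [Omega] when the second argument is a Hermite root vector *)

Section OmegaJacobian.
Local Open Scope classical_set_scope.
Variables (R : realType) (n : nat) (sigma : R) (a w : 'rV[R]_n).
Hypothesis sigma_gt0 : 0 < sigma.
Local Notation T := (exp_deriv2 (- (sigma / 2))).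
Hypotheses (w_incr : increasing w).
Hypothesis (wE : poly_of_roots w = T (poly_of_roots a)).

Lemma Omega_hermite_roots (x : 'rV[R]_n) :
  Omega x (hermite_roots n sigma) = root_vec n (T (poly_of_roots x)).
Proof.
have [_ hE] := hermite_rootsP n sigma_gt0.
by rewrite /Omega hE fconv_hermite ?size_poly_of_roots.
Qed.

Let nbhs_a_filter : Filter (nbhs a). Proof. exact: nbhs_filter. Qed.
#[local] Existing Instance nbhs_a_filter.

Let f (x : 'rV[R]_n) := Omega x (hermite_roots n sigma).

(* [hybrid x 0 = a] and [hybrid x n = x]: changing one root at a time writes
   [poly_of_roots x - poly_of_roots a] as a telescoping sum. *)
Let hybrid (x : 'rV[R]_n) (j : nat) : 'rV[R]_n :=
  \row_k (if (k < j)%N then x 0 k else a 0 k).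

Let hybrid_a j : hybrid a j = a.
Proof. by apply/rowP => k; rewrite mxE if_same. Qed.

Lemma poly_of_roots_telescope x : poly_of_roots x - poly_of_roots a =
  \sum_j (a 0 j - x 0 j) *: cofactor_poly (hybrid x j) j.
Proof.
have hn : hybrid x n = x by apply/rowP => k; rewrite mxE ltn_ord.
have h0 : hybrid x 0 = a by apply/rowP => k; rewrite mxE.
transitivity (poly_of_roots (hybrid x n) - poly_of_roots (hybrid x 0)).
  by rewrite hn h0.
have := telescope_sumr (fun j => poly_of_roots (hybrid x j)) (leq0n n).
rewrite big_mkord => <-; apply: eq_bigr => j _.
rewrite (poly_of_rootsD1 _ j) (poly_of_rootsD1 (hybrid x j) j).
(* The step from [j] to [j + 1] moves only root [j], which the cofactor at [j] omits. *)
have -> : cofactor_poly (hybrid x j.+1) j = cofactor_poly (hybrid x j) j.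
  apply: eq_bigr => k kj; congr ('X - _%:P); rewrite !mxE ltnS leq_eqVlt.
  by rewrite -val_eqE in kj; rewrite (negPf kj).
by rewrite !mxE leqnn ltnn -mul_polyC polyCB; ring.
Qed.

Let p_monic (x : 'rV[R]_n) : T (poly_of_roots x) \is monic.
Proof. exact/exp_deriv2_monic/poly_of_roots_monic. Qed.

Let size_p (x : 'rV[R]_n) : size (T (poly_of_roots x)) = n.+1.
Proof. by rewrite size_exp_deriv2 size_poly_of_roots. Qed.

Let p_cvg : poly_cvg a (fun x => T (poly_of_roots x)).
Proof.
apply: (@poly_cvg_exp_deriv2 _ _ _ _ n.+1) => [x|]; first by rewrite size_poly_of_roots.
by apply: poly_cvg_prod => i _; apply: poly_cvg_XsubC; exact: coord_continuous.
Qed.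

Let f_cvg i : (fun x => f x 0 i) @ a --> w 0 i.
Proof.
rewrite (_ : (fun _ => _) = fun x => root_vec n (T (poly_of_roots x)) 0 i).
  exact: (root_vec_cvg p_monic size_p p_cvg w_incr wE).
by apply/funext => x; rewrite /f Omega_hermite_roots.
Qed.

Let f_roots : \forall x \near a, poly_of_roots (f x) = T (poly_of_roots x).
Proof.
apply: filterS (near_root_vec p_monic size_p p_cvg w_incr wE) => x.
by rewrite /f Omega_hermite_roots.
Qed.

Let f_a : f a = w.
Proof. by rewrite /f Omega_hermite_roots -wE root_vec_increasing. Qed.

(** Row [j], column [i], since increments act as row vectors. The numerator comes from the
    telescoped change of [T P], the denominator from factoring [X - w_i] out of [T P_a]. *)
Let C (x : 'rV[R]_n) : 'M[R]_n := \matrix_(j, i)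
  ((T (cofactor_poly (hybrid x j) j)).[f x 0 i] / (cofactor_poly w i).[f x 0 i]).

Let cofactor_f_cvg i :
  (fun x => (cofactor_poly w i).[f x 0 i]) @ a --> (cofactor_poly w i).[w 0 i].
Proof.
have := @cvg_horner _ _ a n (fun=> cofactor_poly w i) (fun x => f x 0 i).
rewrite f_a; apply; [by move=> x; rewrite size_cofactor_poly| |exact: f_cvg].
move=> k; exact: cvg_cst.
Qed.

Let cofactor_w_neq0 i : (cofactor_poly w i).[w 0 i] != 0.
Proof. by rewrite -deriv_poly_of_roots deriv_poly_of_roots_neq0. Qed.

Let C_cvg j i : (fun x => C x j i) @ a --> C a j i.
Proof.
rewrite mxE f_a; rewrite (_ : (fun _ => _) = fun x =>
  (T (cofactor_poly (hybrid x j) j)).[f x 0 i] / (cofactor_poly w i).[f x 0 i]).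
  apply: cvgM; last by apply: cvgV.
  rewrite -f_a; apply: (@cvg_horner _ _ _ n (fun x => T (cofactor_poly (hybrid x j) j))
    (fun x => f x 0 i)); last by rewrite f_a.
    by move=> x; rewrite size_exp_deriv2 size_cofactor_poly.
  apply: (@poly_cvg_exp_deriv2 _ _ _ _ n) => [x|]; first by rewrite size_cofactor_poly.
  apply: poly_cvg_prod => k _; apply: poly_cvg_XsubC.
  rewrite (_ : (fun _ => _) = fun x : 'rV[R]_n => if (k < j)%N then x 0 k else a 0 k).
    rewrite hybrid_a; case: (k < j)%N; [exact: coord_continuous|exact: cvg_cst].
  by apply/funext => x; rewrite mxE.
by apply/funext => x; rewrite mxE.
Qed.

Let f_diff : \forall x \near a, f x - f a = (x - a) *m C x.
Proof.
have ne0 : \forall x \near a, forall i, (cofactor_poly w i).[f x 0 i] != 0.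
  apply: (@filter_forall _ _ (fun i x => (cofactor_poly w i).[f x 0 i] != 0) (nbhs a)
    (nbhs_filter a)) => i.
  apply: cvgr_neq0; [exact: cofactor_f_cvg | exact: cofactor_w_neq0].
near=> x.
have fx : poly_of_roots (f x) = T (poly_of_roots x) by near: x; exact: f_roots.
have nex : forall i, (cofactor_poly w i).[f x 0 i] != 0 by near: x.
apply/rowP => i; rewrite f_a !mxE; apply: (mulIf (nex i)).
(* This value contains the increment [f x i - w_i] as a factor; since [T P_x] vanishes at [f x i],
   it is also minus the value of [T (P_x - P_a)]. *)
transitivity (T (poly_of_roots a)).[f x 0 i].
  by rewrite -wE (poly_of_rootsD1 w i) hornerM hornerXsubC.
have := congr1 (fun q => (T q).[f x 0 i]) (poly_of_roots_telescope x).
rewrite /= raddfB hornerD hornerN /= -fx root_poly_of_roots sub0r => /(congr1 -%R).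
rewrite opprK => ->; rewrite raddf_sum horner_sum mulr_suml -sumrN.
apply: eq_bigr => j _ /=; rewrite [exp_deriv2 _ _]linearZ hornerZ !mxE mulrA divfK //.
by rewrite -mulNr opprB.
Unshelve. all: by end_near. Qed.

Lemma D1Omega_hermite : D1Omega a (hermite_roots n sigma) =
  \matrix_(i, j) ((T (cofactor_poly a j)).[w 0 i] /
                  (T (poly_of_roots a))^`().[w 0 i]).
Proof.
rewrite /D1Omega -[fun _ => _]/f (jacobian_caratheodory f_diff C_cvg).
apply/matrixP => i j; rewrite !mxE f_a hybrid_a -wE.
by rewrite deriv_poly_of_roots.
Qed.

End OmegaJacobian.

(** * Linear algebra of an orthogonal eigenbasis *)

Section OrthogonalEigenbasis.
Variables (R : realType) (n : nat).
Implicit Types (u v x : 'cV[R]_n).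

Lemma dotvE u v : dotv u v = (u^T *m v) 0 0.
Proof. by rewrite mxE; apply: eq_bigr => i _; rewrite mxE. Qed.

Lemma dotvZr c u v : dotv u (c *: v) = c * dotv u v.
Proof. by rewrite !dotvE -scalemxAr mxE. Qed.

Lemma dotvZl c u v : dotv (c *: u) v = c * dotv u v.
Proof. by rewrite !dotvE linearZ -scalemxAl mxE. Qed.

Lemma dotv_gt0 u : u != 0 -> 0 < dotv u u.
Proof.
move=> /cV0Pn[i ui].
rewrite /dotv (bigD1 i) //= ltr_wpDr ?sumr_ge0 //.
  by move=> j _; rewrite -expr2 sqr_ge0.
by rewrite -expr2 exprn_even_gt0.
Qed.

Lemma orthogonal_basis (s : n.-tuple 'cV[R]_n) :
  (forall i j : 'I_n, i != j -> dotv s`_i s`_j = 0) ->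
  (forall i : 'I_n, s`_i != 0) -> basis_of fullv s.
Proof.
move=> orth nz; rewrite basisEfree subvf size_tuple dimvf dim_matrix mulr1 leqnn.
rewrite !andbT; apply/freeP => k hk i; apply: (mulIf (lt0r_neq0 (dotv_gt0 (nz i)))).
transitivity (dotv s`_i (\sum_j k j *: s`_j)).
  rewrite [RHS]dotvE mulmx_sumr summxE (bigD1 i) //= big1 ?addr0.
    by rewrite -dotvE dotvZr.
  by move=> j ji; rewrite -dotvE dotvZr orth ?mulr0 // eq_sym.
by rewrite hk mul0r dotvE mulmx0 mxE.
Qed.

Variables (V : 'I_n -> 'cV[R]_n) (A : 'M[R]_n) (lambda : 'I_n -> R).
Hypothesis V_orth : forall i j, i != j -> dotv (V i) (V j) = 0.
Hypothesis V_neq0 : forall i, V i != 0.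
Hypothesis V_eigen : forall i, A *m V i = lambda i *: V i.

(** The eigenvectors are the columns of [B], left unnormalized; [d] holds their squared lengths, so
    [B^T B = diag d] replaces orthogonality of [B]. *)
Let B : 'M[R]_n := \matrix_(i, k) V k i 0.
Let d : 'rV[R]_n := \row_k dotv (V k) (V k).
Let L : 'rV[R]_n := \row_k lambda k.

Let BTB : B^T *m B = diag_mx d.
Proof.
apply/matrixP => i j; rewrite !mxE.
transitivity (dotv (V i) (V j)); first by apply: eq_bigr => k _; rewrite !mxE.
by have [->|/V_orth] := eqVneq i j.
Qed.

Let AB : A *m B = B *m diag_mx L.
Proof.
apply/matrixP => i k; rewrite mul_mx_diag !mxE.
have /colP/(_ i) := V_eigen k; rewrite !mxE mulrC => <-.
by apply: eq_bigr => j _; rewrite mxE.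
Qed.

Let d_gt0 k : 0 < d 0 k. Proof. by rewrite mxE dotv_gt0. Qed.

Let B_unit : B \in unitmx.
Proof.
have : B^T *m B \in unitmx.
  rewrite BTB unitmxE det_diag unitfE; apply/prodf_neq0 => k _.
  by rewrite lt0r_neq0.
by rewrite unitmx_mul => /andP[].
Qed.

Let coordK x : B *m (invmx B *m x) = x. Proof. exact: mulKVmx. Qed.

Let dotvB x y : dotv (B *m x) (B *m y) = \sum_k d 0 k * (x k 0 * y k 0).
Proof.
rewrite dotvE trmx_mul mulmxA -(mulmxA x^T) BTB mxE; apply: eq_bigr => k _.
by rewrite mul_mx_diag !mxE; ring.
Qed.

Let AB_col x : A *m (B *m x) = B *m (diag_mx L *m x).
Proof. by rewrite !mulmxA AB. Qed.

Let diagL x k : (diag_mx L *m x) k 0 = lambda k * x k 0.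
Proof. by rewrite mul_diag_mx !mxE. Qed.

(** [B^T A B] is a product of two diagonal matrices, hence symmetric, and [B] is invertible. *)
Lemma eigenbasis_symmetric : A^T = A.
Proof.
have h : B^T *m A *m B = diag_mx d *m diag_mx L.
  by rewrite -mulmxA AB mulmxA BTB.
have : (B^T *m A *m B)^T = B^T *m A *m B.
  by rewrite h trmx_mul !tr_diag_mx diag_mxC.
rewrite !trmx_mul trmxK mulmxA => /(can_inj (mulmxK B_unit)).
by apply: (can_inj (mulKmx _)); rewrite unitmx_tr.
Qed.

Lemma eigenbasis_positive_definite :
  (forall k, 0 < lambda k) -> positive_definite A.
Proof.
move=> l0 x x0; rewrite -(coordK x) AB_col dotvB.
set y := invmx B *m x; have /cV0Pn[k yk] : y != 0.
  by apply: contraNneq x0 => y0; rewrite -(coordK x) -/y y0 mulmx0.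
have E j : d 0 j * (y j 0 * (diag_mx L *m y) j 0) = d 0 j * lambda j * y j 0 ^+ 2.
  by rewrite diagL; ring.
under eq_bigr do rewrite E.
rewrite (bigD1 k) //= ltr_wpDr ?sumr_ge0 //.
  by move=> j _; apply: mulr_ge0; [apply: mulr_ge0; exact: ltW | exact: sqr_ge0].
by apply: mulr_gt0; [apply: mulr_gt0 | rewrite exprn_even_gt0].
Qed.

(** [eigenvalue] refers to row vectors, hence the use of symmetry for one inclusion. For the other,
    a left eigenvector [v] gives a nonzero left eigenvector [v B] of [diag L], and any nonzero entry
    of it picks out some [lambda k]. *)
Lemma eigenbasis_spec : spec A = [set lambda k | k in setT]%classic.
Proof.
apply/seteqP; split=> a /=; last first.
  move=> [k _ <-]; apply/eigenvalueP; exists (V k)^T.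
    by rewrite -[A]trmxK -trmx_mul eigenbasis_symmetric V_eigen linearZ.
  by apply: contraNneq (V_neq0 k) => h; rewrite -[V k]trmxK h trmx0.
move=> /eigenvalueP[v vA v0].
have /rV0Pn[k vk] : v *m B != 0.
  by apply: contraNneq v0 => vB0; rewrite -(mulmxK B_unit v) vB0 mul0mx.
exists k => //; apply: (mulfI vk).
have /rowP/(_ k) : v *m B *m diag_mx L = a *: (v *m B).
  by rewrite -mulmxA -AB mulmxA vA scalemxAl.
by rewrite mul_mx_diag !mxE => ->; rewrite mulrC.
Qed.

(** On the complement of [V k0] the coordinate [y_k0] is 0, so [lambda k0], possibly larger, drops
    out of the sum of [d_k lambda_k^2 y_k^2]. The bound is attained at the normalized [V k1]. *)
Lemma eigenbasis_opnorm_on (k0 k1 : 'I_n) : k1 != k0 ->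
  (forall k, 0 <= lambda k) -> (forall k, k != k0 -> lambda k <= lambda k1) ->
  opnorm_on [set x | dotv (V k0) x = 0]%classic A = lambda k1.
Proof.
move=> k10 l0 lk1; rewrite /opnorm_on; set S := (X in sup X).
have ubS : ubound S (lambda k1).
  move=> _ [x [/= x_orth x1] <-]; rewrite -(coordK x) AB_col.
  set y := invmx B *m x; have y0 : y k0 0 = 0.
    have := x_orth; rewrite -(coordK x) -/y (_ : V k0 = B *m delta_mx k0 0).
      rewrite dotvB (bigD1 k0) //= big1 ?addr0; last first.
        by move=> j jk; rewrite [delta_mx _ _ _ _]mxE (negPf jk) mul0r mulr0.
      rewrite [delta_mx _ _ _ _]mxE !eqxx mul1r => /eqP; rewrite mulf_eq0 (gt_eqF (d_gt0 _)).
      by move=> /eqP.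
    by rewrite -colE; apply/colP => i; rewrite !mxE.
  rewrite -[leRHS]mulr1 (le_trans _ (ler_wpM2l (l0 k1) x1)) //.
  rewrite /enorm -[X in X * _](ger0_norm (l0 k1)) -sqrtr_sqr -sqrtrM ?sqr_ge0 //.
  rewrite ler_wsqrtr // -[in leRHS](coordK x) -/y !dotvB mulr_sumr ler_sum // => k _.
  rewrite diagL; have [->|kk0] := eqVneq k k0; first by rewrite y0 !mulr0.
  have -> : d 0 k * (lambda k * y k 0 * (lambda k * y k 0)) =
    lambda k ^+ 2 * (d 0 k * (y k 0 * y k 0)) by ring.
  apply: ler_wpM2r; first by apply: mulr_ge0; [exact: ltW | rewrite -expr2 sqr_ge0].
  by rewrite ler_pXn2r ?nnegrE ?lk1.
have enormZ c v : 0 <= c -> enorm (c *: v) = c * enorm v.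
  move=> c0; rewrite /enorm dotvZl dotvZr mulrA -expr2 sqrtrM ?sqr_ge0 //.
  by rewrite sqrtr_sqr ger0_norm.
have Sk1 : S (lambda k1).
  have e0 : 0 < enorm (V k1) by rewrite sqrtr_gt0 dotv_gt0.
  have e1 : enorm ((enorm (V k1))^-1 *: V k1) = 1.
    by rewrite enormZ ?invr_ge0 ?ltW // mulVf // gt_eqF.
  exists ((enorm (V k1))^-1 *: V k1) => /=.
    by split; [rewrite dotvZr V_orth ?mulr0 // eq_sym | rewrite e1].
  by rewrite -scalemxAr V_eigen scalerA mulrC -scalerA enormZ // e1 mulr1.
apply/eqP; rewrite eq_le; apply/andP; split.
  by apply: ge_sup => //; exists (lambda k1).
by apply: ub_le_sup => //; exists (lambda k1).
Qed.

End OrthogonalEigenbasis.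

(** * Eigenvectors and spectrum of the Hermite Jacobian *)

Section HermiteJacobian.
Variables (R : realType) (n : nat) (tau sigma : R).
Hypotheses (tau_gt0 : 0 < tau) (sigma_gt0 : 0 < sigma).

Lemma hermite_jac_mul_vec m : (1 <= m <= n)%N ->
  hermite_jac n tau sigma *m hermite_vec n m tau = hermite_vec n m (tau + sigma).
Proof.
move=> /andP[m_gt0 m_le].
have [a_incr aE] := hermite_rootsP n tau_gt0.
have [w_incr wE] := hermite_rootsP n (addr_gt0 tau_gt0 sigma_gt0).
have wTa : poly_of_roots (hermite_roots n (tau + sigma)) =
    exp_deriv2 (- (sigma / 2)) (poly_of_roots (hermite_roots n tau)).
  by rewrite wE aE exp_deriv2_hermite.
rewrite /hermite_jac (D1Omega_hermite sigma_gt0 w_incr wTa).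
(* As [m >= 1], the degree is below [n] and interpolation at the [n] nodes is exact. *)
have sz : (size (hermite n tau)^`(m) <= n)%N.
  rewrite derivn_hermite (leq_trans (size_scale_leq _ _)) // size_hermite.
  by lia.
have := congr1 (exp_deriv2 (- (sigma / 2))) (lagrange_interpolation a_incr sz).
rewrite exp_deriv2_derivn exp_deriv2_hermite aE [exp_deriv2 _ _]linear_sum => /= hE.
have eZ c q : exp_deriv2 (- (sigma / 2)) (c *: q) = c *: exp_deriv2 (- (sigma / 2)) q.
  exact: linearZ.
apply/colP => i; rewrite !mxE hE horner_sum exp_deriv2_hermite mulr_suml -sumrN.
by apply: eq_bigr => j _; rewrite !mxE eZ hornerZ; ring.
Qed.

Lemma powR_half_exp (r : R) k : 0 <= r -> r `^ (k%:R / 2) = Num.sqrt r ^+ k.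
Proof. by move=> r0; rewrite mulrC powRrM powR12_sqrt // powR_mulrn ?sqrtr_ge0. Qed.

Lemma hermite_jac_eigen m : (1 <= m <= n)%N ->
  hermite_jac n tau sigma *m hermite_vec n m tau =
  (tau / (tau + sigma)) `^ ((m%:R - 1) / 2) *: hermite_vec n m tau.
Proof.
move=> hm; rewrite hermite_jac_mul_vec //.
have s0 : 0 < tau + sigma by rewrite addr_gt0.
have r0 : 0 < tau / (tau + sigma) by rewrite divr_gt0.
(* Chosen so that [c^2 tau = tau + sigma]; the scaling factor [c^-(m-1)] is then the eigenvalue. *)
pose c := (Num.sqrt (tau / (tau + sigma)))^-1.
have c0 : 0 < c by rewrite invr_gt0 sqrtr_gt0.
have e : c ^+ 2 * tau = tau + sigma.
  by rewrite exprVn sqr_sqrtr ?ltW // invf_div mulfVK // gt_eqF.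
rewrite -[X in hermite_vec _ _ X]e hermite_vec_scale //; last by lia.
congr (_ *: _); case: m hm => // m _.
by rewrite -natr1 addrK powR_half_exp ?ltW // exprVn invrK.
Qed.

Local Notation r := (tau / (tau + sigma)).

(** Zero-based indexing: [k] stands for [m = k + 1], which turns [r^((m-1)/2)] into the [k]-th power
    of [sqrt r]. *)
Let V (k : 'I_n) := hermite_vec n k.+1 tau.
Let lambda (k : 'I_n) := Num.sqrt r ^+ k.

Let r_gt0 : 0 < r. Proof. by rewrite divr_gt0 // addr_gt0. Qed.

Let r_lt1 : r < 1.
Proof. by rewrite ltr_pdivrMr ?addr_gt0 // mul1r ltrDl. Qed.

Let n_gt0 (k : 'I_n) : (0 < n)%N. Proof. exact: leq_ltn_trans (ltn_ord k). Qed.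

Let V_orth i j : i != j -> dotv (V i) (V j) = 0.
Proof.
by move=> ij; apply: hermite_vec_orthogonal; rewrite ?(n_gt0 i) ?ltn_ord ?eqSS.
Qed.

Let V_neq0 i : V i != 0.
Proof. by apply: hermite_vec_neq0; rewrite ?(n_gt0 i) ?ltn_ord. Qed.

Let V_eigen i : hermite_jac n tau sigma *m V i = lambda i *: V i.
Proof.
rewrite hermite_jac_eigen; last by rewrite ltn_ord.
by rewrite -natr1 addrK powR_half_exp // ltW.
Qed.

Lemma hermite_vec_basis :
  basis_of fullv [seq hermite_vec n m tau | m <- iota 1 n].
Proof.
set s := [seq _ | _ <- _].
have sz : size s == n by rewrite size_map size_iota.
have sE (i : 'I_n) : s`_i = V i.
  by rewrite (nth_map 0%N) ?size_iota // nth_iota.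
apply: (orthogonal_basis (s := Tuple sz)) => [i j ij|i]; rewrite /= !sE.
  exact: V_orth.
exact: V_neq0.
Qed.

Lemma hermite_jac_symmetric :
  (hermite_jac n tau sigma)^T = hermite_jac n tau sigma.
Proof. exact: eigenbasis_symmetric V_orth V_neq0 V_eigen. Qed.

Lemma hermite_jac_positive_definite :
  positive_definite (hermite_jac n tau sigma).
Proof.
apply: (eigenbasis_positive_definite V_orth V_neq0 V_eigen) => k.
by rewrite exprn_gt0 // sqrtr_gt0.
Qed.

Lemma hermite_jac_spec : spec (hermite_jac n tau sigma) =
  [set Num.sqrt r ^+ k | k in [set k : nat | (k < n)%N]]%classic.
Proof.
rewrite (eigenbasis_spec V_orth V_neq0 V_eigen); apply/seteqP; split=> a /=.
  by move=> [k _ <-]; exists k.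
by move=> [k hk <-]; exists (Ordinal hk).
Qed.

Lemma hermite_jac_opnorm : (2 <= n)%N ->
  opnorm_on (@orth_ones R n) (hermite_jac n tau sigma) = Num.sqrt r.
Proof.
(* [k0] is [m = 1], with eigenvector [- 1_n] and eigenvalue 1; [k1] is [m = 2], with the largest
   remaining eigenvalue because [r < 1]. *)
move=> n2; pose k0 := Ordinal (ltnW n2); pose k1 := Ordinal n2.
have -> : @orth_ones R n = [set x | dotv (V k0) x = 0]%classic.
  apply/seteqP; rewrite /V /= hermite_vec1 // -scaleN1r.
  split=> x /=; rewrite dotvZl; first by move=> ->; rewrite mulr0.
  by move=> /eqP; rewrite mulf_eq0 oppr_eq0 oner_eq0 => /eqP.
rewrite (eigenbasis_opnorm_on V_orth V_neq0 V_eigen (k1 := k1)) //.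
- by move=> k; rewrite exprn_ge0 // sqrtr_ge0.
- move=> k kk0; rewrite /lambda /= ler_wiXn2l ?sqrtr_ge0 //.
    by rewrite -sqrtr1 ler_wsqrtr // ltW.
  by rewrite lt0n; apply: contra kk0 => /eqP h; apply/eqP/val_inj.
Qed.

End HermiteJacobian.

Theorem theoremA1 (R : realType) (n : nat) (tau sigma : R)
    (hn : (2 <= n)%N) (htau : 0 < tau) (hsigma : 0 < sigma) :
  (forall m m' : nat, (1 <= m <= n)%N -> (1 <= m' <= n)%N -> m != m' ->
     dotv (hermite_vec n m tau) (hermite_vec n m' tau) = 0)
  /\ basis_of fullv [seq hermite_vec n m tau | m <- iota 1 n]
  /\ (forall m : nat, (1 <= m <= n)%N ->
        hermite_jac n tau sigma *m hermite_vec n m tau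
        = (tau / (tau + sigma)) `^ ((m%:R - 1) / 2) *: hermite_vec n m tau)
  /\ (hermite_jac n tau sigma)^T = hermite_jac n tau sigma
  /\ positive_definite (hermite_jac n tau sigma)
  /\ opnorm_on (@orth_ones R n) (hermite_jac n tau sigma)
     = Num.sqrt (tau / (tau + sigma))
  /\ spec (hermite_jac n tau sigma)
     = [set (tau / (tau + sigma)) `^ ((m%:R - 1) / 2)
         | m in [set m : nat | (1 <= m <= n)%N]]%classic
  /\ spec (hermite_jac n tau tau)
     = [set 2 `^ (- (k%:R / 2)) | k in [set k : nat | (k < n)%N]]%classic.
Proof.
have r0 : 0 <= tau / (tau + sigma) by rewrite divr_ge0 ?addr_ge0 ?ltW.
have half : tau / (tau + tau) = 2^-1.
  by rewrite -mulr2n -[tau *+ 2]mulr_natl invfM mulrCA divff ?mulr1 ?gt_eqF.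
split; first by move=> m m'; apply: hermite_vec_orthogonal => //; exact: ltnW.
split; first exact: hermite_vec_basis.
split; first by move=> m; exact: hermite_jac_eigen.
split; first exact: hermite_jac_symmetric.
split; first exact: hermite_jac_positive_definite.
split; first exact: hermite_jac_opnorm.
split; rewrite hermite_jac_spec //; apply/seteqP; split=> a /=.
- by move=> [k hk <-]; exists k.+1 => //; rewrite -natr1 addrK powR_half_exp.
- move=> [[|k] //= hk <-]; exists k => //.
  by rewrite -natr1 addrK powR_half_exp.
- move=> [k hk <-]; exists k => //.
  by rewrite powRN powR_half_exp // -exprVn -sqrtrV // half.
- move=> [k hk <-]; exists k => //.
  by rewrite powRN powR_half_exp // -exprVn -sqrtrV // half.
Qed.
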